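(* Let $M\subseteq\mathbb{R}^m$ be nonempty, let $F:M\to L(E^n)$ be a fuzzy $n$-cell number-valued function and let $t\in M$. Then the subdifferential $\partial F(t)$ is a convex subset of $(L(E^n))^m$; that is, $\lambda u+(1-\lambda)v\in\partial F(t)$ for all $u,v\in\partial F(t)$ and all $\lambda\in[0,1]$.
   Context: A fuzzy set is a function $u:\mathbb{R}^n\to[0,1]$; its level sets are $[u]^r=\{x:u(x)\ge r\}$ for $r\in(0,1]$ and $[u]^0=\overline{\{x:u(x)>0\}}$. $u$ is a fuzzy number ($u\in E^n$) if $u(x_0)=1$ for some $x_0$, $u(\lambda x+(1-\lambda)y)\ge\min(u(x),u(y))$ for all $x,y$ and $\lambda\in[0,1]$, $u$ is upper semicontinuous, and $[u]^0$ is compact. $L(E^n)$ (the fuzzy $n$-cell numbers) is the set of $u\in E^n$ with $[u]^r=\prod_{i=1}^n[u_i^-(r),u_i^+(r)]$ for all $r\in[0,1]$. Addition and scalar multiplication are levelwise: $[u+v]^r=[u]^r+[v]^r$, $[ku]^r=k[u]^r$ (and componentwise on $(L(E^n))^m$). Order on $L(E^n)$: $u\le v$ iff $u_i^-(r)\le v_i^-(r)$ and $u_i^+(r)\le v_i^+(r)$ for all $i$ and all $r\in[0,1]$. For boxes $A,B$ in $\mathbb{R}^n$, $A\ominus_{gH}B=C$ means $A=B+C$ or $B=A+(-1)C$. The $g$-difference $u\ominus_g v$ is the fuzzy number with level sets $[u\ominus_g v]^r=\mathrm{cl}\big(\mathrm{conv}\bigcup_{\beta\ge r}([u]^\beta\ominus_{gH}[v]^\beta)\big)$,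 $r\in[0,1]$; it need not exist. If it exists for $u,v\in L(E^n)$, then $[u\ominus_g v]^r=\prod_{i=1}^n[\inf_{\beta\ge r}\min\{u_i^-(\beta)-v_i^-(\beta),u_i^+(\beta)-v_i^+(\beta)\},\ \sup_{\beta\ge r}\max\{u_i^-(\beta)-v_i^-(\beta),u_i^+(\beta)-v_i^+(\beta)\}]$. For $v=(v_1,\dots,v_m)\in(L(E^n))^m$ and $d\in\mathbb{R}^m$, $v\cdot d=\sum_{j=1}^m d_jv_j\in L(E^n)$. A vector $v\in(L(E^n))^m$ is a subgradient of $F$ at $t\in M$ if for every $z\in M$ the $g$-difference $F(z)\ominus_gF(t)$ exists and $F(z)\ominus_gF(t)\ge v\cdot(z-t)$; $\partial F(t)$ is the set of all subgradients of $F$ at $t$. *)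

(* Defs.v *)
From HB Require Import structures.
From mathcomp Require Import all_boot all_order all_algebra.
From mathcomp Require Import all_classical all_reals all_analysis.

Set Implicit Arguments.
Unset Strict Implicit.
Unset Printing Implicit Defensive.

Import Order.TTheory GRing.Theory Num.Theory.
Import numFieldNormedType.Exports.

Local Open Scope classical_set_scope.
Local Open Scope ring_scope.

Section Boxes.
Variables (R : realType) (n : nat).
Implicit Types (A B C : set 'rV[R]_n) (a b : 'rV[R]_n).

Definition box a b : set 'rV[R]_n :=
  [set x | forall i, a 0 i <= x 0 i <= b 0 i].

Definition is_box C :=
  exists a b, (forall i, a 0 i <= b 0 i) /\ C = box a b.

Definition mink_add A B : set 'rV[R]_n := [set x + y | x in A & y in B].

Definition mink_scale (k : R) A : set 'rV[R]_n := [set k *: x | x in A].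

Definition conv_hull A : set 'rV[R]_n := smallest (@convex_set R 'rV[R]_n) A.

(* The difference of two boxes is sought among (nonempty, compact) boxes,
   where it is unique; it need not exist when n >= 2. *)
Definition is_gH_diff A B C :=
  is_box C /\ (A = mink_add B C \/ B = mink_add A (mink_scale (-1) C)).

End Boxes.

Section FuzzyNumbers.
Variables (R : realType) (n : nat).

Definition fuzzy : Type := 'rV[R]_n -> R.

Implicit Types (u v w : fuzzy) (r : R) (L : R -> set 'rV[R]_n).

Definition level u r : set 'rV[R]_n :=
  if r == 0 then closure [set x | 0 < u x] else [set x | r <= u x].

Definition upper_semicontinuous u :=
  forall x a, u x < a -> \forall y \near x, u y < a.

Record fuzzy_number u : Prop := FuzzyNumber {
  fuzzy_range : forall x, 0 <= u x <= 1;
  fuzzy_normal : exists x0, u x0 = 1;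
  fuzzy_quasiconcave : forall x y (lam : R), 0 <= lam <= 1 ->
    Num.min (u x) (u y) <= u (lam *: x + (1 - lam) *: y);
  fuzzy_usc : upper_semicontinuous u;
  fuzzy_compact : compact (level u 0) }.

(* u_i^-(r) and u_i^+(r), as the vectors of the extremities of the projections
   of [u]^r on the coordinate axes *)
Definition lo u r : 'rV[R]_n := \row_i inf [set x 0 i | x in level u r].
Definition hi u r : 'rV[R]_n := \row_i sup [set x 0 i | x in level u r].

Definition cell_number u :=
  fuzzy_number u /\
  forall r, 0 <= r <= 1 -> level u r = box (lo u r) (hi u r).

Definition fuzzy_le u v :=
  forall (i : 'I_n) r, 0 <= r <= 1 ->
    lo u r 0 i <= lo v r 0 i /\ hi u r 0 i <= hi v r 0 i.

Definition has_levels L w :=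
  fuzzy_number w /\ forall r, 0 <= r <= 1 -> level w r = L r.

Lemma has_levels_unique L u v : has_levels L u -> has_levels L v -> u = v.
Proof.
have H w w' : has_levels L w -> has_levels L w' -> forall x, w x <= w' x.
  move=> [fw Lw] [fw' Lw'] x; have /andP[w0 w1] := fuzzy_range fw x.
  have [wx0|wx0] := eqVneq (w x) 0.
    by rewrite wx0; case/andP: (fuzzy_range fw' x).
  have r01 : 0 <= w x <= 1 by rewrite w0.
  have : level w (w x) x by rewrite /level (negbTE wx0) /=.
  by rewrite Lw// -Lw'// /level (negbTE wx0).
by move=> Lu Lv; apply/funext => x; apply/le_anti; rewrite !H.
Qed.

(* The fuzzy number with level sets L; the junk value, used when there is none,
   is not a fuzzy number. *)
Definition of_levels L : fuzzy := xget (fun=> 0) [set w | has_levels L w].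

Definition fuzzy_add u v : fuzzy :=
  of_levels (fun r => mink_add (level u r) (level v r)).

Definition fuzzy_scale (k : R) u : fuzzy :=
  of_levels (fun r => mink_scale k (level u r)).

Definition fuzzy_zero : fuzzy := fun x => (x == 0)%:R.

(* w is the g-difference of u and v; in particular the gH-differences of all
   the level sets have to exist. *)
Definition is_g_diff u v w :=
  exists C : R -> set 'rV[R]_n,
    (forall b, 0 <= b <= 1 -> is_gH_diff (level u b) (level v b) (C b)) /\
    has_levels
      (fun r => closure (conv_hull (\bigcup_(b in [set b | r <= b <= 1]) C b)))
      w.

End FuzzyNumbers.

Arguments fuzzy_zero {R n}.

Section Subdifferential.
Variables (R : realType) (m n : nat).

Definition fuzzy_vec : Type := 'I_m -> fuzzy R n.

Implicit Types (u v : fuzzy_vec) (d z t : 'rV[R]_m).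

Definition cell_vec v := forall j, cell_number (v j).

Definition fuzzy_vec_add u v : fuzzy_vec := fun j => fuzzy_add (u j) (v j).

Definition fuzzy_vec_scale (k : R) v : fuzzy_vec :=
  fun j => fuzzy_scale k (v j).

Definition fuzzy_dot v d : fuzzy R n :=
  \big[@fuzzy_add R n/fuzzy_zero]_(j < m) fuzzy_scale (d 0 j) (v j).

(* The order is that of n-cell numbers, so the g-difference has to be one. *)
Definition subgradient (M : set 'rV[R]_m) (F : 'rV[R]_m -> fuzzy R n) t v :=
  cell_vec v /\
  forall z, M z -> exists w,
    [/\ is_g_diff (F z) (F t) w, cell_number w &
        fuzzy_le (fuzzy_dot v (z - t)) w].

Definition subdifferential (M : set 'rV[R]_m) (F : 'rV[R]_m -> fuzzy R n) t :
  set fuzzy_vec := [set v | subgradient M F t v].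

End Subdifferential.

(* Main.v *)
(* The levels of a cell number u are the boxes with endpoints u_i^-(r) and
   u_i^+(r), and a family of boxes arises in this way exactly when, for all i,
   the functions u_i^- and - u_i^+ are nondecreasing on [0, 1], left-continuous
   on ]0, 1] and right-continuous at 0, with u_i^- <= u_i^+. These conditions
   are stable under sums and nonnegative scalings, and a negative scalar swaps
   u_i^- and - u_i^+; hence sums and multiples of cell numbers exist and act
   linearly on the endpoints. So the endpoints of (lam u + (1 - lam) v) . d are
   the convex combinations of those of u . d and v . d. As the gH-difference of
   two boxes is unique, both subgradient inequalities have the same g-difference
   on the right, and they can be averaged. *)
Require Import Defs.
From HB Require Import structures.
From mathcomp Require Import all_boot all_order all_algebra.
From mathcomp Require Import all_classical all_reals all_analysis.
From mathcomp Require Import lra.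

Set Implicit Arguments.
Unset Strict Implicit.
Unset Printing Implicit Defensive.

Import Order.TTheory GRing.Theory Num.Theory.
Import numFieldNormedType.Exports.

Local Open Scope classical_set_scope.
Local Open Scope ring_scope.

(** * Minkowski arithmetic of boxes *)

Section BoxArithmetic.
Variables (R : realType) (n : nat).
Implicit Types (a b c d : 'rV[R]_n) (A B C : set 'rV[R]_n).

Lemma box_lo a b : (forall i, a 0 i <= b 0 i) -> box a b a.
Proof. by move=> ab i; rewrite lexx ab. Qed.

Lemma box_hi a b : (forall i, a 0 i <= b 0 i) -> box a b b.
Proof. by move=> ab i; rewrite lexx ab. Qed.

Lemma box_convex a b (x y : 'rV[R]_n) (k : R) : 0 <= k <= 1 ->
  box a b x -> box a b y -> box a b (k *: x + (1 - k) *: y).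
Proof.
move=> /andP[k0 k1] xB yB i; rewrite !mxE.
have /andP[ax xb] := xB i; have /andP[ay yb] := yB i.
by apply/andP; split; nra.
Qed.

Lemma box_compact a b : compact (box a b).
Proof.
have := @rV_compact R n (fun i => `[a 0 i, b 0 i]%classic).
move=> /(_ (fun i => @segment_compact _ _ _)).
by congr compact; apply/seteqP; split=> x xB i; have := xB i; rewrite /= in_itv.
Qed.

Lemma box_closed a b : closed (box a b).
Proof.
apply: compact_closed; last exact: box_compact.
exact: (@norm_hausdorff R 'rV[R]_n).
Qed.

(** Lets [inf] and [sup] of the projections read the corners off a box. The order is needed in every
    coordinate: one reversed interval would empty the whole box. *)
Lemma coord_box a b i : (forall i, a 0 i <= b 0 i) ->
  [set x 0 i | x in box a b] = `[a 0 i, b 0 i]%classic.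
Proof.
move=> ab; apply/seteqP; split=> [_ [x xB <-]|y]; rewrite /= in_itv//=.
move=> yi; exists (\row_j if j == i then y else a 0 j);
  last by rewrite mxE eqxx.
by move=> j; rewrite mxE; case: eqVneq => [->//|_]; rewrite lexx ab.
Qed.

Lemma box_inj a b c d : (forall i, a 0 i <= b 0 i) ->
  (forall i, c 0 i <= d 0 i) -> box a b = box c d -> a = c /\ b = d.
Proof.
move=> ab cd E.
by split; apply/rowP => i; have := coord_box i ab; rewrite E (coord_box i cd);
  [move/(congr1 inf); rewrite !inf_itvcc|move/(congr1 sup); rewrite !sup_itvcc].
Qed.

Lemma mink_add_box a b c d : (forall i, a 0 i <= b 0 i) ->
  (forall i, c 0 i <= d 0 i) ->
  mink_add (box a b) (box c d) = box (a + c) (b + d).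
Proof.
move=> ab cd; apply/seteqP; split=> [_ [x xB] [y yB <-] i|z zB].
  by rewrite !mxE; have := xB i; have := yB i; lra.
(* Splitting [z] as [x + (z - x)] requires [x] to lie above both [a] and [z - d]; the smallest such
   [x] also meets the upper bounds [b] and [z - c]. *)
pose x : 'rV[R]_n := \row_i Num.max (a 0 i) (z 0 i - d 0 i).
exists x; last exists (z - x); last by rewrite addrC subrK.
all: move=> i; have := zB i; have := ab i; have := cd i; rewrite !mxE.
all: by case: (leP (a 0 i) (z 0 i - d 0 i)) => ?; lra.
Qed.

Lemma mink_scale_box_ge0 (k : R) a b : 0 <= k -> (forall i, a 0 i <= b 0 i) ->
  mink_scale k (box a b) = box (k *: a) (k *: b).
Proof.
move=> k0 ab; apply/seteqP; split=> [_ [x xB <-] i|z zB].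
  by have /andP[ax xb] := xB i; rewrite !mxE !ler_wpM2l.
have [k_0|kN0] := eqVneq k 0.
  exists a; first exact: box_lo.
  by apply/rowP => i; have := zB i; rewrite k_0 !mxE !mul0r -eq_le => /eqP.
have kp : 0 < k by rewrite lt_def kN0.
exists (k^-1 *: z); last by rewrite scalerA divff// scale1r.
move=> i; have := zB i; rewrite !mxE.
by rewrite ler_pdivlMl// ler_pdivrMl// => ->.
Qed.

Lemma box_opp a b : mink_scale (-1) (box a b) = box (- b) (- a).
Proof.
apply/seteqP; split=> [_ [x xB <-] i|z zB].
  by have := xB i; rewrite !mxE; lra.
exists (- z); last by rewrite scaleN1r opprK.
by move=> i; have := zB i; rewrite !mxE; lra.
Qed.

Lemma mink_scaleA (k l : R) A :
  mink_scale k (mink_scale l A) = mink_scale (k * l) A.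
Proof.
apply/seteqP; split=> [_ [_ [x xA <-] <-]|_ [x xA <-]].
  by exists x => //; rewrite scalerA.
by exists (l *: x); [exists x|rewrite scalerA].
Qed.

Lemma mink_scale_box_le0 (k : R) a b : k <= 0 -> (forall i, a 0 i <= b 0 i) ->
  mink_scale k (box a b) = box (k *: b) (k *: a).
Proof.
(* Factor [k] as [- k] times [-1]: a reflection followed by a nonnegative scaling. *)
move=> k0 ab; rewrite -[k]opprK -mulrN1 -mink_scaleA box_opp.
rewrite mink_scale_box_ge0 ?oppr_ge0//; last by move=> i; rewrite !mxE lerN2.
by rewrite mulrN1 opprK !scaleNr !scalerN !opprK.
Qed.

Lemma is_gH_diff_unique a b c d C C' : (forall i, a 0 i <= b 0 i) ->
  (forall i, c 0 i <= d 0 i) ->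
  is_gH_diff (box a b) (box c d) C -> is_gH_diff (box a b) (box c d) C' ->
  C = C'.
Proof.
move=> ab cd.
(* Both alternatives force the same endpoints, in one order or the other. *)
suff H C1 : is_gH_diff (box a b) (box c d) C1 ->
    C1 = box (\row_i Num.min (a 0 i - c 0 i) (b 0 i - d 0 i))
             (\row_i Num.max (a 0 i - c 0 i) (b 0 i - d 0 i)).
  by move=> /H-> /H->.
move=> [[e [f [ef ->]]] E].
suff E' i : a 0 i = c 0 i + e 0 i /\ b 0 i = d 0 i + f 0 i \/
    c 0 i = a 0 i - f 0 i /\ d 0 i = b 0 i - e 0 i.
  by congr box; apply/rowP => i; rewrite mxE;
    have := ef i; case: (E' i) => -[? ?];
    case: (leP (a 0 i - c 0 i) (b 0 i - d 0 i)) => ? ?; lra.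
case: E => [|].
  rewrite mink_add_box// => /box_inj[]//.
    by move=> j; rewrite !mxE lerD.
  by move=> -> ->; left; rewrite !mxE.
rewrite box_opp mink_add_box//; last by move=> j; rewrite !mxE lerN2.
move=> /box_inj[]//.
  by move=> j; rewrite !mxE lerB.
by move=> -> ->; right; rewrite !mxE.
Qed.

End BoxArithmetic.

(** * Monotone functions with one-sided continuity *)

Section EndpointFunctions.
Variable R : realType.
Implicit Types (f g : R -> R).

(* The conditions that characterize r |-> u_i^-(r) and r |-> - u_i^+(r). *)
Record endpoint_fun f : Prop := EndpointFun {
  endpoint_homo : forall r s, 0 <= r -> r <= s -> s <= 1 -> f r <= f s;
  endpoint_left : forall r, 0 < r <= 1 -> f s @[s --> r^'-] --> f r;
  endpoint_right0 : f s @[s --> 0^'+] --> f 0 }.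

Lemma endpoint_funD f g : endpoint_fun f -> endpoint_fun g ->
  endpoint_fun (fun r => f r + g r).
Proof.
move=> [fh fl f0] [gh gl g0]; split.
- by move=> r s r0 rs s1; rewrite lerD ?fh ?gh.
- by move=> r r01; apply: cvgD; [exact: fl|exact: gl].
- exact: cvgD.
Qed.

Lemma endpoint_funZ (k : R) f : 0 <= k -> endpoint_fun f ->
  endpoint_fun (fun r => k * f r).
Proof.
move=> k0 [fh fl f0]; split.
- by move=> r s r0 rs s1; rewrite ler_wpM2l ?fh.
- by move=> r r01; apply: cvgMr; exact: fl.
- exact: cvgMr.
Qed.

Lemma endpoint_fun_cst (c : R) : endpoint_fun (fun=> c).
Proof. by split=> *; [|exact: cvg_cst..]. Qed.

(** For a monotone function a one-sided limit only needs approximation by single values: from below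
    on []0, r[] for the left limit at [r], from above on []0, 1]] for the right limit at 0. *)
Lemma endpoint_funP f :
  (forall r s, 0 <= r -> r <= s -> s <= 1 -> f r <= f s) ->
  (forall r c, 0 < r <= 1 -> (forall s, 0 < s < r -> f s <= c) -> f r <= c) ->
  (forall c, f 0 < c -> exists s, 0 < s <= 1 /\ f s < c) ->
  endpoint_fun f.
Proof.
move=> fh fl f0; split=> // [r /andP[r0 r1]|].
- apply/cvgrPdist_lt => e e0.
  have [s /andP[s0 sr] fs] : exists2 s, 0 < s < r & f r - e < f s.
    (* Otherwise [f r - e] would bound [f] on []0, r[], hence also [f r]. *)
    apply/not_exists2P => H; have : f r <= f r - e.
      apply: fl => [|s s0r]; first by rewrite r0.
      by case: (H s) => // /negP; rewrite -leNgt.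
    by lra.
  near=> x.
  have sx : s < x by near: x; exact: nbhs_left_gt.
  have xr : x < r by near: x; exact: nbhs_left_lt.
  have := fh s x (ltW s0) (ltW sx) (le_trans (ltW xr) r1).
  have := fh x r (ltW (lt_trans s0 sx)) (ltW xr) r1.
  by rewrite ltr_norml; lra.
- apply/cvgrPdist_lt => e e0.
  have [|s [/andP[s0 s1] fs]] := f0 (f 0 + e); first by lra.
  near=> x.
  have x0 : 0 < x by near: x; exact: nbhs_right_gt.
  have xs : x < s by near: x; exact: nbhs_right_lt.
  have := fh 0 x (lexx _) (ltW x0) (le_trans (ltW xs) s1).
  have := fh x s (ltW x0) (ltW xs) s1.
  by rewrite ltr_norml; lra.
Unshelve. all: by end_near. Qed.

End EndpointFunctions.

(** * Levels and endpoints of cell numbers *)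

Section Cells.
Variables (R : realType) (n : nat).
Implicit Types (u v w : fuzzy R n) (L : R -> set 'rV[R]_n)
  (a b : R -> 'rV[R]_n).

Definition endpoints a b :=
  [/\ forall i, endpoint_fun (fun r => a r 0 i),
      forall i, endpoint_fun (fun r => - b r 0 i) &
      forall r i, 0 <= r <= 1 -> a r 0 i <= b r 0 i].

Lemma level_gt0 u r : 0 < r -> level u r = [set x | r <= u x].
Proof. by move=> r0; rewrite /level gt_eqF. Qed.

Lemma level_le u r s : 0 <= r -> r <= s -> level u s `<=` level u r.
Proof.
rewrite le_eqVlt => /predU1P[<-|r0 rs]; last first.
  by rewrite !level_gt0 ?(lt_le_trans r0)// => x; exact: le_trans.
rewrite le_eqVlt => /predU1P[<-//|s0]; rewrite level_gt0// /level eqxx.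
by move=> x sx; apply: subset_closure; exact: lt_le_trans sx.
Qed.

Lemma level0_closure u (x : 'rV[R]_n) i :
  level u 0 x -> forall e : R, 0 < e ->
  exists y : 'rV[R]_n, 0 < u y /\ `|x 0 i - y 0 i| < e.
Proof.
move=> + e e0; rewrite /level eqxx => /(_ (ball x e)) [].
  exact: nbhsx_ballx.
move=> y [uy xy]; exists y; split=> //.
by have := xy.2 0 i; rewrite /ball/=.
Qed.

(** A point where [u] equals 1 lies in every level, so no level is an empty box. *)
Lemma cell_number_le u r i : cell_number u -> 0 <= r <= 1 ->
  lo u r 0 i <= hi u r 0 i.
Proof.
move=> [fu Lu] r01; have [x ux] := fuzzy_normal fu.
have : level u r x.
  have /andP[r0 r1] := r01; apply: (level_le r0 r1).
  by rewrite level_gt0//= ux.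
by rewrite Lu// => /(_ i) /andP[]; exact: le_trans.
Qed.

Lemma level_left u r (x : 'rV[R]_n) : 0 < r ->
  (forall s, 0 < s < r -> level u s x) -> level u r x.
Proof.
move=> r0 H; rewrite level_gt0//= leNgt; apply/negP => xr.
(* A midpoint strictly between [u x] and [r]; the maximum with 0 keeps [s] positive even if [u x] is
   negative. *)
pose s := (Num.max (u x) 0 + r) / 2.
have [xs sr] : u x < s /\ 0 < s < r.
  by rewrite /s; case: (leP (u x) 0) => ?; lra.
by have := H _ sr; case/andP: sr => s0 _; rewrite level_gt0//= leNgt xs.
Qed.

(** Monotonicity comes from the nesting of levels, left continuity from [level_left], and right
    continuity at 0 from the 0-level being a closure. *)
Lemma cell_number_endpoints u : cell_number u -> endpoints (lo u) (hi u).
Proof.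
move=> cu; have [fu Lu] := cu.
have lohi (r : R) i := @cell_number_le u r i cu.
have lo_mem (r : R) : 0 <= r <= 1 -> level u r (lo u r).
  by move=> r01; rewrite Lu//; apply: box_lo => i; exact: lohi.
have hi_mem (r : R) : 0 <= r <= 1 -> level u r (hi u r).
  by move=> r01; rewrite Lu//; apply: box_hi => i; exact: lohi.
have mono (r s : R) i : 0 <= r -> r <= s -> s <= 1 ->
    lo u r 0 i <= lo u s 0 i /\ hi u s 0 i <= hi u r 0 i.
  move=> r0 rs s1.
  have r01 : 0 <= r <= 1 by rewrite r0 (le_trans rs).
  have s01 : 0 <= s <= 1 by rewrite s1 (le_trans r0).
  have := level_le r0 rs (lo_mem _ s01); have := level_le r0 rs (hi_mem _ s01).
  by rewrite Lu// => /(_ i)/andP[_ ->] /(_ i)/andP[->].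
(* A point [x] of the 0-level is approximated by some [y] with [u y] positive. Then [s = u y] works:
   the box at level [s] contains [y]. *)
have near0 i (x : 'rV[R]_n) (e : R) : level u 0 x -> 0 < e -> exists s : R,
    [/\ 0 < s <= 1, lo u s 0 i < x 0 i + e & x 0 i - e < hi u s 0 i].
  move=> x0 e0; have [y [uy xy]] := @level0_closure u x i x0 e e0.
  have /andP[_ y1] := fuzzy_range fu y.
  have : level u (u y) y by rewrite level_gt0/=.
  rewrite Lu; last by rewrite y1 ltW.
  move=> /(_ i) yi; exists (u y); rewrite uy y1.
  by move: xy; rewrite ltr_norml => xy; split=> //; lra.
have z01 : 0 <= (0 : R) <= 1 by rewrite lexx ler01.
split=> // i.
- apply: endpoint_funP => [r s r0 rs s1|r c /andP[r0 r1] H|c H].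
  + by have [] := mono r s i r0 rs s1.
  + have r01 : 0 <= r <= 1 by rewrite r1 ltW.
    rewrite leNgt; apply/negP => cr.
    (* The lower corner at [r] with its [i]-th coordinate decreased to [c]. As [c] bounds the
       earlier lower endpoints, [x] lies in all levels below [r], hence in level [r], against
       [c < lo u r 0 i]. *)
    pose x : 'rV[R]_n := \row_j if j == i then c else lo u r 0 j.
    have : level u r x.
      apply: level_left => // s sr; have := H _ sr; have /andP[s0 s_r] := sr.
      have s01 : 0 <= s <= 1 by rewrite !ltW//= (lt_le_trans s_r).
      have := level_le (ltW s0) (ltW s_r) (lo_mem _ r01).
      rewrite Lu// => B Hc j; have := B j; rewrite [x 0 j]mxE.
      by case: eqVneq => [->|//]; lra.
    by rewrite Lu// => /(_ i); rewrite [x 0 i]mxE eqxx; lra.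
  + have [|s [s01 sc _]] := near0 i _ (c - lo u 0 0 i) (lo_mem _ z01).
      by rewrite subr_gt0.
    by exists s; split=> //; move: sc; rewrite addrC subrK.
- apply: endpoint_funP => [r s r0 rs s1|r c /andP[r0 r1] H|c H].
  + by rewrite lerN2; have [] := mono r s i r0 rs s1.
  + have r01 : 0 <= r <= 1 by rewrite r1 ltW.
    rewrite leNgt; apply/negP => cr.
    pose x : 'rV[R]_n := \row_j if j == i then - c else hi u r 0 j.
    have : level u r x.
      apply: level_left => // s sr; have := H _ sr; have /andP[s0 s_r] := sr.
      have s01 : 0 <= s <= 1 by rewrite !ltW//= (lt_le_trans s_r).
      have := level_le (ltW s0) (ltW s_r) (hi_mem _ r01).
      rewrite Lu// => B Hc j; have := B j; rewrite [x 0 j]mxE.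
      by case: eqVneq => [->|//]; lra.
    by rewrite Lu// => /(_ i); rewrite [x 0 i]mxE eqxx; lra.
  + have [|s [s01 _ sc]] := near0 i _ (c + hi u 0 0 i) (hi_mem _ z01).
      by lra.
    by exists s; split=> //; lra.
Qed.

(** * Fuzzy numbers built from endpoint functions *)

Lemma endpoints_box_le a b r s : endpoints a b -> 0 <= r -> r <= s -> s <= 1 ->
  box (a s) (b s) `<=` box (a r) (b r).
Proof.
move=> [ea eb _] r0 rs s1 x xs i; have /andP[ax xb] := xs i.
have := endpoint_homo (ea i) r0 rs s1; have := endpoint_homo (eb i) r0 rs s1.
by rewrite lerN2 => /(le_trans xb)-> /le_trans->.
Qed.

Lemma endpoints_box_left a b r (x : 'rV[R]_n) : endpoints a b -> 0 < r <= 1 ->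
  (forall s, 0 <= s < r -> box (a s) (b s) x) -> box (a r) (b r) x.
Proof.
move=> [ea eb _] r01 H i; have /andP[r0 _] := r01.
have nearB : \forall s \near r^'-, box (a s) (b s) x.
  near=> s; apply: H.
  have -> : s < r by near: s; exact: nbhs_left_lt.
  by rewrite andbT; apply: ltW; near: s; exact: nbhs_left_gt.
apply/andP; split.
  apply: (cvgr_to_le (endpoint_left (ea i) r01)).
  by apply: filterS nearB => s /(_ i)/andP[].
rewrite -lerN2; apply: (cvgr_to_le (endpoint_left (eb i) r01)).
by apply: filterS nearB => s /(_ i)/andP[_]; rewrite lerN2.
Unshelve. all: by end_near. Qed.

(* A point of the box at 0 is approximated by its projection on the boxes at
   small positive r. *)
Lemma endpoints_box0 a b : endpoints a b ->
  box (a 0) (b 0) `<=`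
  closure (\bigcup_(r in [set r : R | 0 < r <= 1]) box (a r) (b r)).
Proof.
move=> eab x xB A /nbhs_ballP[e /= e0 xeA]; have [ea eb ab] := eab.
have na i : \forall r \near (0 : R)^'+, `|a 0 0 i - a r 0 i| < e.
  by have /cvgrPdist_lt/(_ _ e0) := endpoint_right0 (ea i).
have nb i : \forall r \near (0 : R)^'+, `|- b 0 0 i - - b r 0 i| < e.
  by have /cvgrPdist_lt/(_ _ e0) := endpoint_right0 (eb i).
near (0 : R)^'+ => r.
have r0 : 0 < r by near: r; exact: nbhs_right_gt.
have r1 : r < 1 by near: r; exact: nbhs_right_lt.
have r01 : 0 <= r <= 1 by rewrite !ltW.
(* There are finitely many coordinates, so one [r] serves them all. *)
have na' : forall i, `|a 0 0 i - a r 0 i| < e.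
  by near: r; apply: filter_forall => i; exact: na.
have nb' : forall i, `|- b 0 0 i - - b r 0 i| < e.
  by near: r; apply: filter_forall => i; exact: nb.
pose y : 'rV[R]_n := \row_i Num.max (a r 0 i) (Num.min (x 0 i) (b r 0 i)).
have xy : ball x e y.
  split=> // k i; rewrite /ball/= (ord1 k) mxE.
  have := na' i; have := nb' i; have := ab r i r01; have := xB i.
  rewrite !ltr_norml.
  case: (leP (x 0 i) (b r 0 i)) => ?.
    by case: (leP (a r 0 i) (x 0 i)) => ? ? ? ? ?; lra.
  by case: (leP (a r 0 i) (b r 0 i)) => ? ? ? ? ?; lra.
exists y; split; last exact: xeA.
exists r; first by rewrite /= r0 ltW.
move=> i; rewrite mxE; have := ab r i r01.
case: (leP (x 0 i) (b r 0 i)) => ?.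
  by case: (leP (a r 0 i) (x 0 i)) => ? ?; lra.
by case: (leP (a r 0 i) (b r 0 i)) => ? ?; lra.
Unshelve. all: by end_near. Qed.

(** The membership degree of [x] is the supremum of the [r] whose box contains [x]. Left continuity
    makes positive suprema attained, so the positive levels are the boxes; right continuity at 0
    yields the 0-level. *)
Lemma endpoints_has_levels a b : endpoints a b ->
  exists w, has_levels (fun r => box (a r) (b r)) w.
Proof.
move=> eab; have [ea eb ab] := eab.
(* Adding 0 keeps the set nonempty and gives degree 0 to the points outside all boxes. *)
pose S x := [set r : R | r = 0 \/ 0 <= r <= 1 /\ box (a r) (b r) x].
pose w (x : 'rV[R]_n) : R := sup (S x).
have S0 x : S x 0 by left.
have S1 x : ubound (S x) 1.
  by move=> _ [->|[/andP[_ ?] _]] //; exact: ler01.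
have supS x : has_sup (S x) by split; [exists 0|exists 1].
have w_ge x r : 0 <= r <= 1 -> box (a r) (b r) x -> r <= w x.
  by move=> r01 xr; apply: ub_le_sup; [exists 1|right].
have w_le1 x : w x <= 1 by apply: ge_sup; [exists 0|].
have w_ge0 x : 0 <= w x by apply: ub_le_sup; [exists 1|].
have w_box x r : 0 < r -> r <= w x -> box (a r) (b r) x.
  move=> r0 rw; have r1 := le_trans rw (w_le1 x).
  apply: (endpoints_box_left eab); first by rewrite r0.
  move=> s /andP[s0 sr].
  have rs0 : 0 < r - s by rewrite subr_gt0.
  (* As [r <= w x], some [t] in [S x] exceeds [s]; the boxes being nested, the one at [s] contains
     [x]. *)
  have [t St] := @sup_adherent _ (S x) (r - s) rs0 (supS x).
  rewrite -/(w x) => wt.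
  have st : s < t by lra.
  case: St => [t0|[/andP[_ t1] xt]]; first by move: st; rewrite t0 ltNge s0.
  by apply: (endpoints_box_le eab s0 (ltW st) t1).
have Lw r : 0 <= r <= 1 -> level w r = box (a r) (b r).
  rewrite le_eqVlt => /andP[/predU1P[<- _|r0 r1]]; last first.
    rewrite level_gt0//; apply/seteqP; split=> x; first exact: w_box.
    by apply: w_ge; rewrite ltW.
  rewrite /level eqxx; apply/seteqP; split=> x.
    move=> xw; apply: (@box_closed _ _ (a 0) (b 0)); move: x xw.
    apply: closure_subset => x /= wx.
    apply: (endpoints_box_le eab (lexx 0) (ltW wx) (w_le1 x)).
    exact: w_box.
  move=> /(endpoints_box0 eab); apply: closure_subset => y [s /andP[s0 s1] ys].
  by apply: (lt_le_trans s0); apply: w_ge => //; rewrite ltW.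
exists w; split=> //; split.
- by move=> x; rewrite w_ge0 w_le1.
- exists (a 1); apply/le_anti; rewrite w_le1 w_ge ?lexx ?ler01//.
  by apply: box_lo => i; rewrite ab// lexx ler01.
- move=> x y k k01; set r := Num.min _ _.
  have [r0|r0] := leP r 0; first exact: le_trans (w_ge0 _).
  have r_w : r <= w x /\ r <= w y by rewrite !ge_min !lexx orbT.
  apply: w_ge; first by rewrite ltW//= (le_trans r_w.1).
  by apply: box_convex => //; apply: w_box => //; case: r_w.
- move=> x c xc; have [c1|c1] := ltP 1 c.
    by near=> y; exact: le_lt_trans c1.
  have c0 : 0 < c by exact: le_lt_trans xc.
  have c01 : 0 <= c <= 1 by rewrite ltW.
  (* Upper semicontinuity: [w] is below [c] exactly off the closed box at level [c]. *)
  have : open (~` box (a c) (b c)) by apply: closed_openC; exact: box_closed.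
  rewrite openE => /(_ x); rewrite /interior => H.
  near=> y; have : (~` box (a c) (b c)) y.
    near: y; apply: H => xB; have := w_ge _ _ c01 xB.
    by rewrite leNgt xc.
  by rewrite -Lw// level_gt0//= => /negP; rewrite -ltNge.
- by rewrite Lw ?lexx ?ler01//; exact: box_compact.
Unshelve. all: by end_near. Qed.

(** Existence makes [of_levels] return the genuine fuzzy number instead of its default value, and
    nonempty boxes determine their endpoints. *)
Lemma cell_number_of_levels L a b : endpoints a b ->
  (forall r, 0 <= r <= 1 -> L r = box (a r) (b r)) ->
  [/\ cell_number (of_levels L), has_levels L (of_levels L),
      forall r, 0 <= r <= 1 -> lo (of_levels L) r = a r &
      forall r, 0 <= r <= 1 -> hi (of_levels L) r = b r].
Proof.
move=> eab LE; have [_ _ ab] := eab.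
have [fw Lw] : has_levels L (of_levels L).
  apply: xgetPex; have [w [fw Lw]] := endpoints_has_levels eab.
  by exists w; split=> // r r01; rewrite Lw// LE.
have lo_a r : 0 <= r <= 1 -> lo (of_levels L) r = a r.
  move=> r01; apply/rowP => i.
  rewrite mxE Lw// LE// coord_box ?inf_itvcc ?ab// => j; exact: ab.
have hi_b r : 0 <= r <= 1 -> hi (of_levels L) r = b r.
  move=> r01; apply/rowP => i.
  rewrite mxE Lw// LE// coord_box ?sup_itvcc ?ab// => j; exact: ab.
by split=> //; split=> // r r01; rewrite Lw// LE// lo_a// hi_b.
Qed.

(** * Linear operations on cell numbers, seen on endpoints *)

Lemma cell_number_add u v : cell_number u -> cell_number v ->
  [/\ cell_number (fuzzy_add u v),
      forall r, 0 <= r <= 1 -> lo (fuzzy_add u v) r = lo u r + lo v r &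
      forall r, 0 <= r <= 1 -> hi (fuzzy_add u v) r = hi u r + hi v r].
Proof.
move=> cu cv; have [eul euh ub] := cell_number_endpoints cu.
have [evl evh vb] := cell_number_endpoints cv.
pose L r := mink_add (level u r) (level v r).
have [|r r01|//] := @cell_number_of_levels L
    (fun r => lo u r + lo v r) (fun r => hi u r + hi v r).
  split=> [i|i|r i r01].
  - rewrite (_ : (fun _ => _) = (fun r => lo u r 0 i + lo v r 0 i)).
      exact: endpoint_funD.
    by apply/funext => r; rewrite mxE.
  - rewrite (_ : (fun _ => _) = (fun r => - hi u r 0 i + - hi v r 0 i)).
      exact: (endpoint_funD (euh i) (evh i)).
    by apply/funext => r; rewrite mxE opprD.
  - rewrite [(lo u r + lo v r) 0 i]mxE [(hi u r + hi v r) 0 i]mxE.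
    by rewrite lerD ?ub ?vb.
rewrite /L cu.2// cv.2// mink_add_box// => i; [exact: ub|exact: vb].
Qed.

Lemma cell_number_scale_ge0 (k : R) u : 0 <= k -> cell_number u ->
  [/\ cell_number (fuzzy_scale k u),
      forall r, 0 <= r <= 1 -> lo (fuzzy_scale k u) r = k *: lo u r &
      forall r, 0 <= r <= 1 -> hi (fuzzy_scale k u) r = k *: hi u r].
Proof.
move=> k0 cu; have [el eh ub] := cell_number_endpoints cu.
pose L r := mink_scale k (level u r).
have [|r r01|//] := @cell_number_of_levels L
    (fun r => k *: lo u r) (fun r => k *: hi u r).
  split=> [i|i|r i r01].
  - rewrite (_ : (fun _ => _) = (fun r => k * lo u r 0 i)).
      exact: endpoint_funZ.
    by apply/funext => r; rewrite mxE.
  - rewrite (_ : (fun _ => _) = (fun r => k * - hi u r 0 i)).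
      exact: (endpoint_funZ k0 (eh i)).
    by apply/funext => r; rewrite mxE mulrN.
  - by rewrite [(k *: lo u r) 0 i]mxE [(k *: hi u r) 0 i]mxE ler_wpM2l ?ub.
by rewrite /L cu.2// mink_scale_box_ge0// => i; exact: ub.
Qed.

Lemma cell_number_scale_le0 (k : R) u : k <= 0 -> cell_number u ->
  [/\ cell_number (fuzzy_scale k u),
      forall r, 0 <= r <= 1 -> lo (fuzzy_scale k u) r = k *: hi u r &
      forall r, 0 <= r <= 1 -> hi (fuzzy_scale k u) r = k *: lo u r].
Proof.
move=> k0 cu; have [el eh ub] := cell_number_endpoints cu.
have Nk0 : 0 <= - k by rewrite oppr_ge0.
pose L r := mink_scale k (level u r).
have [|r r01|//] := @cell_number_of_levels L
    (fun r => k *: hi u r) (fun r => k *: lo u r).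
  split=> [i|i|r i r01].
  (* Written as a nonnegative multiple of the endpoint function [- hi u]. *)
  - rewrite (_ : (fun _ => _) = (fun r => - k * - hi u r 0 i)).
      exact: (endpoint_funZ Nk0 (eh i)).
    by apply/funext => r; rewrite mxE mulrNN.
  - rewrite (_ : (fun _ => _) = (fun r => - k * lo u r 0 i)).
      exact: endpoint_funZ.
    by apply/funext => r; rewrite mxE mulNr.
  - by rewrite [(k *: lo u r) 0 i]mxE [(k *: hi u r) 0 i]mxE ler_wnM2l ?ub.
by rewrite /L cu.2// mink_scale_box_le0// => i; exact: ub.
Qed.

Lemma cell_number_zero : [/\ cell_number (@fuzzy_zero R n),
  forall r, 0 <= r <= 1 -> lo (@fuzzy_zero R n) r = 0 &
  forall r, 0 <= r <= 1 -> hi (@fuzzy_zero R n) r = 0].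
Proof.
pose L (r : R) : set 'rV[R]_n := box 0 0.
have [|r r01|cw [fw Lw] low hiw] :=
    @cell_number_of_levels L (fun=> 0) (fun=> 0).
- split=> [i|i|r i _]; last by rewrite lexx.
    exact: endpoint_fun_cst.
  exact: endpoint_fun_cst.
- by [].
(* [fuzzy_zero] is given pointwise, so it is matched with the number whose levels are all the
   singleton of 0: degree 1 there, no positive degree elsewhere. *)
suff -> : fuzzy_zero = of_levels L by [].
apply/funext => x; rewrite /fuzzy_zero; have [->|x0] := eqVneq x 0.
  have /andP[_ w1] := fuzzy_range fw 0; apply/le_anti; rewrite w1 andbT.
  have : level (of_levels L) 1 0.
    by rewrite Lw ?lexx ?ler01// => i; rewrite lexx.
  by rewrite level_gt0.
have /andP[w0 w1] := fuzzy_range fw x; apply/le_anti; rewrite w0/= leNgt.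
apply: contra x0 => wx; have : level (of_levels L) (of_levels L x) x.
  by rewrite level_gt0/=.
rewrite Lw ?w0// => xB; apply/eqP/rowP => i; apply/le_anti.
by have := xB i; rewrite andbC.
Qed.

(* "u = k v + (1 - k) w" as seen through the endpoints. *)
Definition convex_comb (k : R) u v w :=
  [/\ cell_number u, cell_number v, cell_number w &
    forall r, 0 <= r <= 1 ->
      lo u r = k *: lo v r + (1 - k) *: lo w r /\
      hi u r = k *: hi v r + (1 - k) *: hi w r].

Lemma convex_comb_scale (k : R) u v : 0 <= k <= 1 ->
  cell_number u -> cell_number v ->
  convex_comb k (fuzzy_add (fuzzy_scale k u) (fuzzy_scale (1 - k) v)) u v.
Proof.
move=> /andP[k0 k1] cu cv; have k1' : 0 <= 1 - k by rewrite subr_ge0.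
have [cku klo khi] := cell_number_scale_ge0 k0 cu.
have [cku' klo' khi'] := cell_number_scale_ge0 k1' cv.
have [ca alo ahi] := cell_number_add cku cku'.
by split=> // r r01; rewrite alo// ahi// klo// klo'// khi// khi'.
Qed.

(** A negative [d] exchanges [lo] and [hi] in all three numbers at once, so the two equations merely
    trade places. *)
Lemma convex_combZ (k d : R) u v w : convex_comb k u v w ->
  convex_comb k (fuzzy_scale d u) (fuzzy_scale d v) (fuzzy_scale d w).
Proof.
move=> [cu cv cw E]; have [d0|/ltW d0] := leP 0 d.
  have [du lou hiu] := cell_number_scale_ge0 d0 cu.
  have [dv lov hiv] := cell_number_scale_ge0 d0 cv.
  have [dw low hiw] := cell_number_scale_ge0 d0 cw.
  split=> // r r01; have [El Eh] := E r r01.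
  rewrite lou// hiu// lov// hiv// low// hiw// El Eh !scalerDr !scalerA.
  by rewrite !(mulrC d).
have [du lou hiu] := cell_number_scale_le0 d0 cu.
have [dv lov hiv] := cell_number_scale_le0 d0 cv.
have [dw low hiw] := cell_number_scale_le0 d0 cw.
split=> // r r01; have [El Eh] := E r r01.
rewrite lou// hiu// lov// hiv// low// hiw// El Eh !scalerDr !scalerA.
by rewrite !(mulrC d).
Qed.

Lemma convex_combD (k : R) u v w u' v' w' :
  convex_comb k u v w -> convex_comb k u' v' w' ->
  convex_comb k (fuzzy_add u u') (fuzzy_add v v') (fuzzy_add w w').
Proof.
move=> [cu cv cw E] [cu' cv' cw' E'].
have [du lou hiu] := cell_number_add cu cu'.
have [dv lov hiv] := cell_number_add cv cv'.
have [dw low hiw] := cell_number_add cw cw'.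
split=> // r r01; have [El Eh] := E r r01; have [El' Eh'] := E' r r01.
rewrite lou// hiu// lov// hiv// low// hiw// El Eh El' Eh' !scalerDr.
by rewrite addrACA; split=> //; rewrite addrACA.
Qed.

Lemma convex_comb0 (k : R) : convex_comb k fuzzy_zero fuzzy_zero fuzzy_zero.
Proof.
have [c l h] := cell_number_zero.
by split=> // r r01; rewrite l// h// !scaler0 addr0.
Qed.

(** * Uniqueness of the g-difference, and averaging of subgradients *)

Lemma is_g_diff_unique u v w w' : cell_number u -> cell_number v ->
  is_g_diff u v w -> is_g_diff u v w' -> w = w'.
Proof.
move=> cu cv [C [dC hC]] [C' [dC' [fw' Lw']]].
apply: (has_levels_unique hC); split=> // r /andP[r0 r1].
rewrite Lw' ?r0//; congr (closure (conv_hull _)).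
(* [C] and [C'] are constrained only on [[0, 1]], which contains every index [b] of the union. *)
apply: eq_bigcupr => b /= /andP[rb b1].
have b01 : 0 <= b <= 1 by rewrite b1 (le_trans r0).
have := dC _ b01; have := dC' _ b01; rewrite cu.2// cv.2//.
by apply: is_gH_diff_unique => i; apply: cell_number_le.
Qed.

End Cells.

Lemma convex_comb_dot (R : realType) (m n : nat) (k : R)
    (u v w : fuzzy_vec R m n) (d : 'rV[R]_m) :
  (forall j, convex_comb k (u j) (v j) (w j)) ->
  convex_comb k (fuzzy_dot u d) (fuzzy_dot v d) (fuzzy_dot w d).
Proof.
move=> H; rewrite /fuzzy_dot; apply: (big_rec3 (convex_comb k)).
  exact: convex_comb0.
by move=> j w' v' u' _ IH; apply: convex_combD => //; exact: convex_combZ.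
Qed.

Theorem theorem3p19 (R : realType) (m n : nat) (M : set 'rV[R]_m)
    (F : 'rV[R]_m -> fuzzy R n) (t : 'rV[R]_m) :
  M !=set0 ->
  (forall z, M z -> cell_number (F z)) ->
  M t ->
  subdifferential M F t `<=` [set v | cell_vec v] /\
  forall (u v : fuzzy_vec R m n) (lam : R),
    subdifferential M F t u -> subdifferential M F t v -> 0 <= lam <= 1 ->
    subdifferential M F t
      (fuzzy_vec_add (fuzzy_vec_scale lam u) (fuzzy_vec_scale (1 - lam) v)).
Proof.
move=> _ cF Mt; split=> [v []//|u v lam [cu Hu] [cv Hv] lam01].
have comb j := convex_comb_scale lam01 (cu j) (cv j).
split=> [j|z Mz]; first by case: (comb j).
have [w [gw cw uw]] := Hu z Mz; have [w' [gw' _ vw']] := Hv z Mz.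
(* Both subgradient inequalities now have the same right-hand side [w]. *)
rewrite -(is_g_diff_unique (cF z Mz) (cF t Mt) gw gw') in vw'.
exists w; split=> // i r r01.
have [_ _ _ /(_ r r01)[dlo dhi]] := convex_comb_dot (z - t) comb.
have [ulo uhi] := uw i r r01; have [vlo vhi] := vw' i r r01.
have /andP[l0 l1] := lam01.
have combE (x y : 'rV[R]_n) :
    (lam *: x + (1 - lam) *: y) 0 i = lam * x 0 i + (1 - lam) * y 0 i.
  by rewrite !mxE.
(* Average the two inequalities with the nonnegative weights [lam] and [1 - lam], which sum to 1. *)
by rewrite dlo dhi !combE; split; nra.
Qed.
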